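(* Let $S_i:\mathcal{H}_i\to\mathcal{H}_i$ and $U_i:\mathcal{H}\to\mathcal{H}$ be weakly regular cutters with $\operatorname{Fix}S_i=Q_i$ and $\operatorname{Fix}U_i=C_i$, $i\in I$. Let $\lambda_k,\mu_k\in[\varepsilon,2-\varepsilon]$, $k\ge 0$, for some $\varepsilon\in(0,1)$, and let $\{i_k\}_{k=0}^\infty\subseteq I$ be an almost cyclic control. Then, for every $x^0\in\mathcal{H}$, the sequence $x^k$ generated by $$x^{k+1}=U_{i_k,\mu_k}\Big(x^k+\frac{\lambda_k}{\|A_{i_k}\|^2}A_{i_k}^*\big(S_{i_k}(A_{i_k}x^k)-A_{i_k}x^k\big)\Big),\qquad k\ge 0,$$ converges weakly to some $x^*\in\Omega$.
   Context: Let $\mathcal{H}$ and $\mathcal{H}_i$, $i\in I:=\{1,2,\dots,p\}$, be real Hilbert spaces, $C_i\subseteq\mathcal{H}$ and $Q_i\subseteq\mathcal{H}_i$ nonempty closed convex subsets, and $A_i:\mathcal{H}\to\mathcal{H}_i$ nonzero bounded linear operators with adjoints $A_i^*$ and operator norms $\|A_i\|$. Put $\Omega:=\bigcap_{i=1}^p\big(C_i\cap A_i^{-1}(Q_i)\big)$; it is assumed throughout that $\Omega\neq\emptyset$. An operator $T:\mathcal{X}\to\mathcal{X}$ on a real Hilbert space $\mathcal{X}$ with a fixed point is called a cutter if $\langle x-Tx,z-Tx\rangle\le 0$ for all $x\in\mathcal{X}$ and all $z\in\operatorname{Fix}T$. $T$ is called weakly regular if $\operatorname{Id}-T$ is demi-closed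 at $0$, i.e., whenever $x_k\rightharpoonup x$ weakly and $x_k-Tx_k\to 0$ in norm, then $x\in\operatorname{Fix}T$. For $\mu\in(0,2)$, $U_{i,\mu}:=(1-\mu)\operatorname{Id}+\mu U_i$ is the $\mu$-relaxation of $U_i$. A sequence $\{i_k\}_{k=0}^\infty\subseteq I$ is an almost cyclic control if there is a constant $s\ge p$ such that $I\subseteq\{i_{k+1},i_{k+2},\dots,i_{k+s}\}$ for every $k\ge 0$. *)

(* Defs.v *)
From HB Require Import structures.
From mathcomp Require Import all_boot all_order all_algebra.
From mathcomp Require Import sesquilinear.
From mathcomp Require Import all_classical all_reals all_analysis.

Set Implicit Arguments.
Unset Strict Implicit.
Unset Printing Implicit Defensive.

Import Order.TTheory GRing.Theory Num.Theory.
Import numFieldNormedType.Exports.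

Local Open Scope classical_set_scope.
Local Open Scope ring_scope.

(* A real Hilbert space is a complete normed module whose norm comes from an
   inner product. For the trivial involution [idfun], a [{dot V for idfun}] is
   a symmetric, positive definite, bilinear form. *)
HB.mixin Record CompleteNormedModule_isHilbert (R : realType) V
    & CompleteNormedModule R V := {
  inner : {dot V for (@idfun R)} ;
  sqr_norm_inner : forall x : V, `|x| ^+ 2 = inner x x
}.

#[short(type="hilbertType")]
HB.structure Definition Hilbert (R : realType) :=
  {V of CompleteNormedModule R V & CompleteNormedModule_isHilbert R V}.

Definition weak_cvg (R : realType) (H : hilbertType R) (u : nat -> H) (l : H) :
  Prop := forall y : H, inner (u k) y @[k --> \oo] --> (inner l y : R).

Definition opnorm (R : realType) (H K : hilbertType R) (A : H -> K) : R :=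
  sup [set `|A x| | x in [set x : H | `|x| <= 1]].

(* For a bounded linear operator, the point selected by [xget] exists (by the
   Riesz representation theorem) and is unique; otherwise the value is
   irrelevant. *)
Definition adjoint (R : realType) (H K : hilbertType R) (A : H -> K) (y : K) :
  H := xget 0 [set z : H | forall x : H, inner (A x) y = inner x z].

Definition Fix (T : Type) (f : T -> T) : set T := [set x | f x = x].

Definition cutter (R : realType) (H : hilbertType R) (T : H -> H) : Prop :=
  Fix T !=set0 /\
  forall x z : H, Fix T z -> inner (x - T x) (z - T x) <= 0.

Definition weakly_regular (R : realType) (H : hilbertType R) (T : H -> H) :
  Prop :=
  forall (u : nat -> H) (x : H),
    weak_cvg u x -> (u k - T (u k) @[k --> \oo] --> (0 : H)) -> Fix T x.

Definition relaxation (R : realType) (H : hilbertType R) (mu : R) (T : H -> H)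
  (x : H) : H := (1 - mu) *: x + mu *: T x.

Definition almost_cyclic (p : nat) (ctrl : nat -> 'I_p) : Prop :=
  exists2 s : nat, (p <= s)%N &
    forall k : nat,
      [set: 'I_p] `<=` ctrl @` [set j : nat | (k + 1 <= j <= k + s)%N].

(* Main.v *)
Require Import Defs.
From mathcomp Require Import all_boot all_order all_algebra.
From mathcomp Require Import sesquilinear.
From mathcomp Require Import all_classical all_reals all_analysis.
From mathcomp Require Import ring lra.

Set Implicit Arguments.
Unset Strict Implicit.
Unset Printing Implicit Defensive.

Import Order.TTheory GRing.Theory Num.Theory.
Import numFieldNormedType.Exports.

Local Open Scope classical_set_scope.
Local Open Scope ring_scope.

(** Fix a solution z. One iteration first moves x to y along the Landweber
    direction g = A^*(S(Ax) - Ax) / N^2, where N is the norm of A, and then moves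
    y along d = Uy - y. A direction v taken at a point a satisfies in both cases
    <v, a - z> + w <= 0 with |v|^2 <= w: for d this is the cutter property of U,
    with w = |d|^2, and for g it is the cutter property of S transported by the
    adjoint, with w = (|S(Ax) - Ax| / N)^2. Expanding the square shows that a
    step of relaxed length t in [eps, 2 - eps] along such a direction decreases
    the squared distance to z by at least eps^2 w ([relaxed_step]). So the
    iterates are Fejer monotone with respect to the solution set, and the
    residuals and displacements of step k are at most constant multiples of
    delta_k, the square root of the decrease of |x_k - z|^2 divided by eps
    ([split_step]). The distances |x_k - z| converge, hence delta_k tends to 0.

    Let l be the weak limit of a subsequence x_(n_j). Almost cyclicity gives,
    for every index i, times m_j within s steps of n_j at which i is the active
    index. Consecutive iterates become arbitrarily close, so x_(m_j) also
    converges weakly to l ([small_steps]); the residuals along m_j vanish, and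
    weak regularity of S_i and U_i puts l in C_i and A_i l in Q_i. Thus every
    weak cluster point is a solution, and Opial's argument for Fejer monotone
    sequences turns this into weak convergence of the whole sequence
    ([fejer_weak_cvg]).

    Two Hilbert space facts support this: the Riesz theorem, which makes the
    adjoint meaningful, and the weak sequential compactness of bounded
    sequences. Both rest on [approx_riesz], an approximate Riesz theorem on
    arbitrary subspaces. *)

(** * Inner products *)

Lemma norm_le_of_quadratic_ge0 (R : realFieldType) (a b c : R) :
  0 <= a -> 0 <= c ->
  (forall t, 0 <= a ^+ 2 + 2 * t * b + t ^+ 2 * c ^+ 2) -> `|b| <= a * c.
Proof.
move=> a0 c0 q; have [c_eq0|c_neq0] := eqVneq c 0.
  have [->|b0] := eqVneq b 0; first by rewrite normr0 mulr_ge0.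
  (* The form is now affine in t with nonzero slope; this t makes it -1. *)
  have := q (- (a ^+ 2 + 1) / (2 * b)).
  suff -> : a ^+ 2 + 2 * (- (a ^+ 2 + 1) / (2 * b)) * b
     + (- (a ^+ 2 + 1) / (2 * b)) ^+ 2 * c ^+ 2 = -1 by rewrite ler0N1.
  by rewrite c_eq0; field.
rewrite -ler_sqr ?nnegrE ?mulr_ge0// exprMn real_normK ?num_real//.
(* The minimum of the form is attained at - b / c ^ 2. *)
have := q (- b / c ^+ 2).
suff -> : a ^+ 2 + 2 * (- b / c ^+ 2) * b + (- b / c ^+ 2) ^+ 2 * c ^+ 2
   = a ^+ 2 - b ^+ 2 / c ^+ 2.
  by rewrite subr_ge0 ler_pdivrMr// exprn_gt0// lt_def c_neq0.
by field.
Qed.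

Section InnerProduct.
Context {R : realType} {H : hilbertType R}.
Implicit Types x y z : H.

Lemma innerC x y : inner x y = inner y x.
Proof. by rewrite hermC expr0 mul1r. Qed.

Lemma sqr_normD x y : `|x + y| ^+ 2 = `|x| ^+ 2 + 2 * inner x y + `|y| ^+ 2.
Proof.
rewrite !sqr_norm_inner linearDl !linearDr /= (innerC y x); ring.
Qed.

Lemma inner_scaler a x y : inner x (a *: y) = a * inner x y.
Proof. by rewrite linearZr. Qed.

Lemma inner_linearr x a y z :
  inner x (a *: y + z) = a * inner x y + inner x z.
Proof. by rewrite linearDr /= inner_scaler. Qed.

Lemma sqr_normDZ t x y :
  `|x + t *: y| ^+ 2 = `|x| ^+ 2 + 2 * t * inner x y + t ^+ 2 * `|y| ^+ 2.
Proof.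
rewrite sqr_normD inner_scaler normrZ exprMn -normrX ger0_norm ?sqr_ge0//; ring.
Qed.

Lemma cauchy_schwarz x y : `|inner x y| <= `|x| * `|y|.
Proof.
apply: norm_le_of_quadratic_ge0 => // t.
by have := sqr_ge0 `|x + t *: y|; rewrite sqr_normDZ; lra.
Qed.
End InnerProduct.

(** * The Riesz representation theorem *)

Section Riesz.
Context {R : realType} {H : hilbertType R}.

Lemma cvg_dist_le {V : normedModType R} {T} {F : set_system T} {FF : Filter F}
    (u : T -> V) l (d : T -> R) c :
  d @ F --> 0 -> (forall k, `|u k - l| <= d k * c) -> u @ F --> l.
Proof.
move=> d0 ud; apply/subr_cvg0; apply: norm_cvg0.
apply: (@squeeze_cvgr _ _ _ _ (cst 0) (fun k => d k * c)).
- by apply: nearW => k; rewrite normr_ge0 ud.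
- exact: cvg_cst.
- by rewrite -(mul0r c); exact: cvgM d0 (cvg_cst c).
Qed.

Lemma cvg_innerl {T} {F : set_system T} {FF : Filter F} (u : T -> H) l y :
  u @ F --> l -> inner (u k) y @[k --> F] --> (inner l y : R).
Proof.
move=> /subr_cvg0/norm_cvg0P ul; apply: (cvg_dist_le ul) => k.
by rewrite -linearBl; exact: cauchy_schwarz.
Qed.

(** Any [m] in [W] whose value [`|m| ^+ 2 - 2 * f m] is within [e ^+ 2] of the
    infimum over [W] works: moving from [m] along [h] changes that value by
    [2 * t * (inner m h - f h) + t ^+ 2 * `|h| ^+ 2], which is never below
    [- e ^+ 2]. Accepting a precision [e] is what
    makes the statement true on subspaces that are not closed. *)
Lemma approx_riesz (W : set H) (f : H -> R) (M e : R) :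
  W 0 -> (forall a x y, W x -> W y -> W (a *: x + y)) -> scalar f ->
  (forall x, W x -> `|f x| <= M * `|x|) -> 0 < e ->
  exists2 m, W m & forall h, W h -> `|inner m h - f h| <= e * `|h|.
Proof.
move=> W0 Wlin flin fM e0.
pose J x := `|x| ^+ 2 - 2 * f x.
have J_ge x : W x -> - M ^+ 2 <= J x.
  move=> /fM; rewrite ler_norml => /andP[_ fx]; rewrite /J.
  have := sqr_ge0 (`|x| - M); rewrite sqrrB; lra.
have infJ : has_inf (J @` W).
  split; first by exists (J 0), 0.
  by exists (- M ^+ 2) => _ [x Wx <-]; exact: J_ge.
have [_ [m Wm <-] Jm] := inf_adherent (exprn_gt0 2 e0) infJ.
exists m => // h Wh.
apply: norm_le_of_quadratic_ge0 => [||t]; [exact: ltW|by []|].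
have Wmth : W (m + t *: h) by rewrite addrC; exact: Wlin.
have := ge_inf infJ.2 (ex_intro2 _ _ _ Wmth erefl).
move: Jm; rewrite /J sqr_normDZ [m + _]addrC flin; lra.
Qed.

(** Two approximate representatives of [f] differ by at most the sum of their
    precisions, as one sees by testing both on their difference. Those of
    precision tending to 0 therefore form a Cauchy sequence, and its limit
    represents [f] exactly. *)
Lemma riesz_representation (f : H -> R) (M : R) :
  scalar f -> (forall x, `|f x| <= M * `|x|) ->
  exists z, forall x, f x = inner x z.
Proof.
move=> flin fM.
have approx n : exists m, forall h, `|inner m h - f h| <= harmonic n * `|h|.
  have [m _ mP] := @approx_riesz setT f M (harmonic n) I (fun _ _ _ _ _ => I)
    flin (fun x _ => fM x) (harmonic_gt0 n).
  by exists m => h; exact: mP.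
have [m mP] := choice approx.
have mB n k : `|m n - m k| <= harmonic n + harmonic k.
  have [->|mnk] := eqVneq (m n) (m k).
    by rewrite subrr normr0 addr_ge0 ?harmonic_ge0.
  have d0 : 0 < `|m n - m k| by rewrite normr_gt0 subr_eq0.
  rewrite -(ler_pM2r d0) -expr2 sqr_norm_inner linearBl.
  have := mP n (m n - m k); have := mP k (m n - m k).
  rewrite !ler_norml mulrDl => /andP[? ?] /andP[? ?]; lra.
have : cvg (m @ \oo).
  apply/cauchy_cvgP/cauchy_exP => e e0.
  have e2 : 0 < e / 2 by rewrite divr_gt0.
  have [N _ hN] := cvgr0_norm_lt _ (@cvg_harmonic R) _ e2.
  have hlt n : (N <= n)%N -> harmonic n < e / 2.
    by move=> Nn; exact: le_lt_trans (ler_norm _) (hN _ Nn).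
  exists (m N); exists N => // n /= Nn; rewrite -ball_normE/=.
  by rewrite (le_lt_trans (mB N n))// [e]splitr ltrD ?hlt.
move=> /cvg_ex[l ml].
exists l => x; rewrite innerC.
have mx : inner (m n) x @[n --> \oo] --> f x.
  by apply: (cvg_dist_le cvg_harmonic) => n; exact: mP.
by apply: (cvg_unique _ mx); [exact: norm_hausdorff|exact: cvg_innerl].
Qed.

End Riesz.

(** * Weak sequential compactness *)

Section WeakCompactness.
Context {R : realType}.

Lemma ultra_bounded_cvg {T} {F : set_system T} {UF : UltraFilter F}
    (f : T -> R) (B : R) :
  (forall k, `|f k| <= B) -> exists l : R, f x @[x --> F] --> l.
Proof.
move=> fB.
have FB : (f @ F) `[- B, B]%classic.
  by apply: nearW => k; rewrite /= in_itv/= -ler_norml.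
have [l [_ lF]] := segment_compact (fmap_proper_filter f _) FB.
exists l => V Vl.
have [//|FnV] := in_ultra_setVsetC (f @^-1` V) UF.
by have [x []] := lF (~` V) V FnV Vl.
Qed.

Context {H : hilbertType R}.

(** The limit of [inner (u k) y] along [F] is a bounded linear functional of
    [y], so it has a Riesz representative. *)
Lemma weak_cluster_functional (F : set_system nat) {UF : UltraFilter F}
    (u : nat -> H) B : (forall k, `|u k| <= B) ->
  exists l, forall y, inner (u k) y @[k --> F] --> (inner l y : R).
Proof.
move=> uB.
have uyB y k : `|inner (u k) y| <= B * `|y|.
  by rewrite (le_trans (cauchy_schwarz _ _))// ler_wpM2r.
have [f /= fcvg] := choice (fun y => ultra_bounded_cvg (UF := UF) (uyB y)).
have flin : scalar f.
  move=> a x y; apply: (cvg_unique _ (fcvg _)); first exact: norm_hausdorff.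
  rewrite /=; under eq_fun do rewrite inner_linearr.
  exact: cvgD (cvgM (cvg_cst a) (fcvg x)) (fcvg y).
have fB y : `|f y| <= B * `|y|.
  rewrite ler_norml; apply/andP; split.
    apply: (cvgr_to_ge (fcvg y)); apply: nearW => k.
    by have := uyB y k; rewrite ler_norml => /andP[].
  apply: (cvgr_to_le (fcvg y)); apply: nearW => k.
  by have := uyB y k; rewrite ler_norml => /andP[].
have [l fl] := riesz_representation flin fB.
by exists l => y; rewrite innerC -fl.
Qed.

(** Let [l] be the weak limit of [u] along an ultrafilter refining [\oo]. One
    can choose [phi j >= j] such that [u (phi j)] is as close to [l]
    as desired when tested against the finitely many vectors [u 0], ..., [u j].
    The set [W] of test vectors along which [u \o phi] converges to [l] is then
    a subspace containing every [u m]. An arbitrary [y] is handled by replacing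
    it with some [m] in [W] for which [m - y] is almost orthogonal to [W]: the
    error is small against each [u k], hence also against [l]. *)
Lemma bounded_weak_cvg_subseq (u : nat -> H) B : (forall k, `|u k| <= B) ->
  exists (phi : nat -> nat) (l : H), phi @ \oo --> \oo /\ weak_cvg (u \o phi) l.
Proof.
move=> uB; have B0 : 0 <= B := le_trans (normr_ge0 _) (uB 0%N).
have [F [UF sF]] := ultraFilterLemma eventually_filter.
have [l lF] := weak_cluster_functional uB.
have ex_phi j : exists k, (j <= k)%N /\
    forall m : 'I_j.+1, `|inner l (u m) - inner (u k) (u m)| < harmonic j.
  apply: (@filter_ex _ F); apply: filterI; first exact: sF (nbhs_infty_ge j).
  by apply: filter_forall => m; exact: cvgr_dist_lt (lF _) _ (harmonic_gt0 j).
have [phi phiP] := choice ex_phi.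
exists phi, l; split.
  apply/cvgnyPge => A; exists A => // j /= Aj.
  exact: leq_trans Aj (phiP j).1.
pose W : set H :=
  [set w | inner (u (phi j)) w @[j --> \oo] --> (inner l w : R)].
have Wu m : W (u m).
  apply/cvgrPdist_le => e e0; near=> j.
  have mj : (m < j.+1)%N by rewrite ltnS; near: j; exact: nbhs_infty_ge.
  rewrite (le_trans (ltW ((phiP j).2 (Ordinal mj))))//.
  rewrite (le_trans (ler_norm _))//; near: j.
  exact: cvgr0_norm_le (@cvg_harmonic R) _ e0.
have Wlin a x y : W x -> W y -> W (a *: x + y).
  move=> Wx Wy; rewrite /W/= inner_linearr.
  under eq_fun do rewrite inner_linearr.
  by apply: cvgD Wy; apply: cvgM Wx; exact: cvg_cst.
have W0 : W 0.
  by have := Wlin (-1) _ _ (Wu 0%N) (Wu 0%N); rewrite scaleN1r addNr.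
move=> y; apply/cvgrPdist_le => e e0.
have d0 : 0 < e / (4 * (B + 1)) by rewrite divr_gt0// mulr_gt0// ltr_wpDl.
set d := e / _ in d0.
have dB : d * B <= e / 4.
  rewrite (@le_trans _ _ (d * (B + 1)))//.
    by rewrite ler_pM2l// lerDl.
  suff -> : d * (B + 1) = e / 4 by [].
  by rewrite /d; field; rewrite gt_eqF// ltr_wpDl.
have [m Wm my] := @approx_riesz _ _ W (inner y) `|y| d W0 Wlin
  (inner_linearr _) (fun _ _ => cauchy_schwarz _ _) d0.
have umy k : `|inner (u k) (m - y)| <= e / 4.
  rewrite innerC linearBl; apply: le_trans (my _ (Wu k)) _.
  by rewrite (le_trans _ dB)// ler_pM2l.
have lmy : `|inner l (m - y)| <= e / 4.
  apply: (cvgr_to_le (cvg_norm (lF (m - y)))).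
  exact: nearW.
have e2 : 0 < e / 2 by rewrite divr_gt0.
move/cvgrPdist_le/(_ _ e2): Wm; apply: filterS => j.
have := umy (phi j); move: lmy; rewrite !linearBr !ler_norml.
move=> /andP[? ?] /andP[? ?] /andP[? ?]; apply/andP; split; lra.
Unshelve. all: by end_near. Qed.

End WeakCompactness.

(** * Bounded linear operators and weak convergence *)

Section WeakConvergence.
Context {R : realType}.

Lemma weak_cvg_sub0 {H : hilbertType R} (u v : nat -> H) l :
  weak_cvg u l -> v k - u k @[k --> \oo] --> (0 : H) -> weak_cvg v l.
Proof.
move=> ul vu y.
have -> : (fun k => inner (v k) y) =
    (fun k => inner (v k - u k) y + inner (u k) y).
  by apply/funext => k; rewrite linearBl /= subrK.
have := cvgD (cvg_innerl (y := y) vu) (ul y).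
by rewrite linear0l add0r; apply.
Qed.

Context {H K : hilbertType R} (A : {linear H -> K}).
Context (A_bounded : bounded_near A (nbhs (0 : H))).

Lemma opnorm_ub x : `|x| <= 1 -> `|A x| <= opnorm A.
Proof.
move=> x1; apply: ub_le_sup; last by exists x.
have [M MA] := (bounded_funP A).2 A_bounded 1.
by exists M => _ [v v1 <-]; exact: MA.
Qed.

Lemma opnorm_ge0 : 0 <= opnorm A.
Proof. by rewrite (le_trans (normr_ge0 (A 0)))// opnorm_ub// normr0. Qed.

Lemma le_opnorm x : `|A x| <= opnorm A * `|x|.
Proof.
have [->|x0] := eqVneq x 0; first by rewrite linear0 !normr0 mulr0.
have nx0 : 0 < `|x| by rewrite normr_gt0.
rewrite -ler_pdivrMr// mulrC.
have := @opnorm_ub (`|x|^-1 *: x).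
rewrite linearZ /= !normrZ normfV normr_id mulVf ?gt_eqF//; exact.
Qed.

Lemma opnorm_gt0 : (exists x, A x != 0) -> 0 < opnorm A.
Proof.
move=> [x Ax]; have := le_opnorm x.
have : 0 < `|A x| by rewrite normr_gt0.
move=> a b; have := lt_le_trans a b; rewrite pmulr_lgt0// normr_gt0.
by apply: contraNneq Ax => ->; rewrite linear0.
Qed.

Lemma inner_adjoint x y : inner (A x) y = inner x (adjoint A y).
Proof.
apply: (xgetPex 0 (P := [set z | forall x, inner (A x) y = inner x z])).
apply: (@riesz_representation _ _ _ (opnorm A * `|y|)).
  by move=> a u v; rewrite innerC linearP inner_linearr !(innerC y).
move=> u; rewrite (le_trans (cauchy_schwarz _ _))// mulrAC ler_wpM2r//.
exact: le_opnorm.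
Qed.

Lemma norm_adjoint_le y : `|adjoint A y| <= opnorm A * `|y|.
Proof.
have [->|z0] := eqVneq (adjoint A y) 0.
  by rewrite normr0 mulr_ge0// opnorm_ge0.
have nz : 0 < `|adjoint A y| by rewrite normr_gt0.
rewrite -(ler_pM2l nz) -expr2 sqr_norm_inner -inner_adjoint.
rewrite (le_trans (ler_norm _))// (le_trans (cauchy_schwarz _ _))//.
by rewrite mulrCA mulrA ler_wpM2r// le_opnorm.
Qed.

Lemma weak_cvg_linear (u : nat -> H) l :
  weak_cvg u l -> weak_cvg (A \o u) (A l).
Proof.
move=> ul y; rewrite inner_adjoint.
by under eq_fun do rewrite /= inner_adjoint; exact: ul.
Qed.

End WeakConvergence.

(** * One step of the method *)

Section Step.
Context {R : realType} {H : hilbertType R}.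

(** The squared distance to [z] changes by
    [2 * t * inner g (x - z) + t ^+ 2 * `|g| ^+ 2 <= - t * (2 - t) * w], and
    both [t] and [2 - t] are at least [eps]. The slack [w] is separate from
    [`|g| ^+ 2] because for the Landweber direction it must measure the
    residual in the image space, which [g] alone does not control. *)
Lemma relaxed_step (x z g : H) (t w eps : R) :
  0 < eps -> eps <= t <= 2 - eps ->
  inner g (x - z) + w <= 0 -> `|g| ^+ 2 <= w ->
  `|x + t *: g - z| ^+ 2 <= `|x - z| ^+ 2 - eps ^+ 2 * w.
Proof.
move=> eps0 /andP[t1 t2] gx gw.
have w0 : 0 <= w := le_trans (sqr_ge0 _) gw.
rewrite addrAC sqr_normDZ (innerC _ g).
have t0 : 0 < t := lt_le_trans eps0 t1.
have tg : t ^+ 2 * `|g| ^+ 2 <= t ^+ 2 * w by rewrite ler_wpM2l ?sqr_ge0.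
have tx : 2 * t * inner g (x - z) <= 2 * t * - w.
  by rewrite ler_wpM2l ?mulr_ge0 ?(ltW t0)//; lra.
have ew : eps ^+ 2 * w <= t * (2 - t) * w.
  by rewrite ler_wpM2r// expr2 ler_pM ?(ltW eps0)//; lra.
nra.
Qed.

Lemma cutter_inner (T : H -> H) x z : cutter T -> Fix T z ->
  inner (T x - x) (x - z) + `|T x - x| ^+ 2 <= 0.
Proof.
move=> [_ cutT] /(cutT x z).
rewrite sqr_norm_inner -linearDr /= [x - z + _]addrC addrA subrK.
by rewrite -(opprB x) -(opprB z) linearNl linearNr opprK.
Qed.

Lemma relaxationE mu (T : H -> H) x :
  relaxation mu T x = x + mu *: (T x - x).
Proof. by rewrite /relaxation scalerBl scale1r scalerBr addrA addrAC. Qed.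

End Step.

Section SplitStep.
Context {R : realType} {H K : hilbertType R} (A : {linear H -> K}).
Context (A_bounded : bounded_near A (nbhs (0 : H))).
Context (A_neq0 : exists x, A x != 0).
Context (S : K -> K) (U : H -> H).
Context (S_cutter : cutter S) (U_cutter : cutter U).

Let N := opnorm A.
Let N0 : 0 < N. Proof. exact: opnorm_gt0. Qed.

Lemma landweber_inner x z : Fix S (A z) ->
  inner (N ^- 2 *: adjoint A (S (A x) - A x)) (x - z)
    + (`|S (A x) - A x| / N) ^+ 2 <= 0.
Proof.
move=> Sz; rewrite innerC inner_scaler -inner_adjoint// innerC linearB.
rewrite exprMn exprVn (mulrC (_ ^+ 2)) -mulrDr.
rewrite pmulr_rle0 ?invr_gt0 ?exprn_gt0//.
exact: cutter_inner.
Qed.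

Lemma landweber_norm x :
  `|N ^- 2 *: adjoint A (S (A x) - A x)| <= `|S (A x) - A x| / N.
Proof.
rewrite normrZ ger0_norm ?invr_ge0 ?sqr_ge0// mulrC ler_pdivrMr ?exprn_gt0//.
rewrite expr2 mulrA divfK ?gt_eqF// mulrC; exact: norm_adjoint_le.
Qed.

(** Adding the decreases of the two substeps gives
    [eps ^+ 2 * ((`|r| / N) ^+ 2 + `|U y - y| ^+ 2)] as a lower bound for the
    decrease of the squared distance, so [delta] dominates [`|r| / N] and
    [`|U y - y|]; the displacements follow since the relaxation parameters are
    at most 2. Every bound has the form [delta * c] so that the sequence of
    deltas alone controls all limits. *)
Lemma split_step (x z : H) (lambda mu eps : R) :
  0 < eps -> eps <= lambda <= 2 - eps -> eps <= mu <= 2 - eps ->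
  Fix S (A z) -> Fix U z ->
  let r := S (A x) - A x in
  let y := x + (lambda / N ^+ 2) *: adjoint A r in
  let x' := relaxation mu U y in
  let delta := Num.sqrt (`|x - z| ^+ 2 - `|x' - z| ^+ 2) / eps in
  [/\ `|x' - z| <= `|x - z|, `|r| <= delta * N, `|U y - y| <= delta * 1,
   `|y - x| <= delta * 2 & `|x' - x| <= delta * 4].
Proof.
move=> eps0 lambdaP muP Sz Uz r y x' delta.
pose g := N ^- 2 *: adjoint A r.
have yE : y = x + lambda *: g by rewrite /y /g scalerA.
have x'E : x' = y + mu *: (U y - y) by rewrite /x' relaxationE.
have gr : `|g| <= `|r| / N := landweber_norm x.
have rN0 : 0 <= `|r| / N by rewrite divr_ge0// ltW.
have descent_y : `|y - z| ^+ 2 <= `|x - z| ^+ 2 - eps ^+ 2 * (`|r| / N) ^+ 2.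
  rewrite yE; apply: relaxed_step => //; first exact: landweber_inner.
  by rewrite ler_sqr ?nnegrE.
have descent_x' :
    `|x' - z| ^+ 2 <= `|y - z| ^+ 2 - eps ^+ 2 * `|U y - y| ^+ 2.
  by rewrite x'E; apply: relaxed_step => //; exact: cutter_inner.
have eps2 : 0 < eps ^+ 2 by rewrite exprn_gt0.
have le_delta a : 0 <= a ->
  eps ^+ 2 * a ^+ 2 <= `|x - z| ^+ 2 - `|x' - z| ^+ 2 -> a <= delta.
  move=> a0 aP; rewrite /delta ler_pdivlMr//.
  rewrite -(ger0_norm (mulr_ge0 a0 (ltW eps0))).
  by rewrite -sqrtr_sqr ler_wsqrtr// exprMn mulrC.
have r2 : 0 <= eps ^+ 2 * (`|r| / N) ^+ 2 by rewrite mulr_ge0 ?sqr_ge0.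
have d2 : 0 <= eps ^+ 2 * `|U y - y| ^+ 2 by rewrite mulr_ge0 ?sqr_ge0.
have r_le : `|r| / N <= delta by apply: le_delta => //; lra.
have d_le : `|U y - y| <= delta by apply: le_delta => //; lra.
have yx : `|y - x| <= delta * 2.
  rewrite yE [x + _]addrC addrK normrZ mulrC.
  rewrite ler_pM// ?(le_trans gr)// ger0_norm; lra.
split => //.
- by rewrite -ler_sqr ?nnegrE//; lra.
- by rewrite -ler_pdivrMr.
- by rewrite mulr1.
have -> : x' - x = (y - x) + mu *: (U y - y) by rewrite x'E addrAC.
rewrite (le_trans (ler_normD _ _))//.
have : `|mu *: (U y - y)| <= delta * 2.
  rewrite normrZ mulrC ler_pM// ger0_norm; lra.
lra.
Qed.

End SplitStep.

(** * Fejer monotone sequences *)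

Section Fejer.
Context {R : realType} {H : hilbertType R}.

Lemma nonincreasing_bounded_cvg (v : nat -> R) :
  (forall k, 0 <= v k) -> (forall k, v k.+1 <= v k) -> cvg (v @ \oo).
Proof.
move=> v0 vS; apply: nonincreasing_is_cvgn; first exact/nonincreasing_seqP.
by exists 0 => _ [k _ <-].
Qed.

(** Bounded sequences have weakly convergent subsequences, so it suffices that
    two subsequential weak limits [l] and [l'] agree. Both lie in [Om], so the
    distances from [x k] to each of them converge, and with them
    [inner (x k) (l - l')], whose limit is both [inner l (l - l')] and
    [inner l' (l - l')]. *)
Lemma fejer_weak_cvg (Om : set H) (x : nat -> H) : Om !=set0 ->
  (forall z k, Om z -> `|x k.+1 - z| <= `|x k - z|) ->
  (forall n l, n @ \oo --> \oo -> weak_cvg (x \o n) l -> Om l) ->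
  exists l, Om l /\ weak_cvg x l.
Proof.
move=> [z0 z0Om] fejer cluster.
have xB k : `|x k| <= `|x 0%N - z0| + `|z0|.
  rewrite -[x k](subrK z0) (le_trans (ler_normD _ _))// lerD2r.
  by elim: k => // k; apply: le_trans; exact: fejer.
have subseq (n : nat -> nat) : n @ \oo --> \oo ->
    exists m l, [/\ n \o m @ \oo --> \oo, Om l & weak_cvg (x \o (n \o m)) l].
  move=> n_oo.
  have [m [l [m_oo xl]]] := bounded_weak_cvg_subseq (fun k => xB (n k)).
  have nm_oo : n \o m @ \oo --> \oo := cvg_comp _ _ m_oo n_oo.
  by exists m, l; split => //; exact: cluster xl.
have uniq (n n' : nat -> nat) l l' : n @ \oo --> \oo -> n' @ \oo --> \oo ->
    Om l -> Om l' -> weak_cvg (x \o n) l -> weak_cvg (x \o n') l' -> l = l'.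
  move=> n_oo n'_oo Oml Oml' xl xl'.
  have dist_cvg z : Om z -> cvg (`|x k - z| ^+ 2 @[k --> \oo]).
    move=> Omz; apply: nonincreasing_bounded_cvg => k; first exact: sqr_ge0.
    by rewrite ler_sqr ?nnegrE// fejer.
  have /cvg_ex[c xc] : cvg (inner (x k) (l - l') @[k --> \oo]).
    have -> : (fun k => inner (x k) (l - l')) = (fun k =>
        (`|x k - l'| ^+ 2 - `|x k - l| ^+ 2) * 2^-1
        + (`|l| ^+ 2 - `|l'| ^+ 2) / 2).
      apply/funext => k; rewrite !sqr_norm_inner !linearBl !linearBr /=.
      by rewrite (innerC l) (innerC l'); field.
    apply: is_cvgD; last exact: is_cvg_cst.
    by apply: is_cvgM; [apply: is_cvgB; exact: dist_cvg|exact: is_cvg_cst].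
  have lc : inner l (l - l') = c.
    by apply: (cvg_unique _ (xl _)); [exact: norm_hausdorff|exact: cvg_comp xc].
  have l'c : inner l' (l - l') = c.
    apply: (cvg_unique _ (xl' _)); first exact: norm_hausdorff.
    exact: cvg_comp xc.
  apply/eqP; rewrite -subr_eq0 -normr_eq0 -sqrf_eq0 sqr_norm_inner linearBl /=.
  by rewrite lc l'c subrr.
have [m [l [m_oo Oml xl]]] := subseq id cvg_id.
exists l; split => // y; apply: contrapT => ncvg.
have [e e0 far] : exists2 e, 0 < e &
    forall N, exists k, (N <= k)%N /\ e <= `|inner l y - inner (x k) y|.
  apply: contrapT => nfar; apply: ncvg; apply/cvgrPdist_lt => e e0.
  apply: contrapT => nnear; apply: nfar; exists e => // N.
  apply: contrapT => nk; apply: nnear; exists N => // k /= Nk.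
  by rewrite ltNge; apply/negP => ek; apply: nk; exists k.
(* A subsequence staying away from [l] against [y] has itself a weakly
   convergent subsequence, whose limit must be [l]. *)
have [n nP] := choice far.
have n_oo : n @ \oo --> \oo.
  apply/cvgnyPge => N; exists N => // k /= Nk.
  exact: leq_trans Nk (nP k).1.
have [m' [l' [m'_oo Oml' xl']]] := subseq n n_oo.
have ll' := uniq _ _ _ _ m_oo m'_oo Oml Oml' xl xl'; rewrite -{}ll' in xl'.
have /cvgrPdist_lt/(_ _ e0)[N _ near_l] := xl' y.
have := near_l N (leqnn N); rewrite ltNge => /negP; apply.
exact: (nP _).2.
Qed.

End Fejer.

(** * Convergence of the split method *)

Section SmallSteps.
Context {R : realType} {V : normedModType R}.

Lemma small_steps (x : nat -> V) (n m : nat -> nat) (s : nat) :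
  x k.+1 - x k @[k --> \oo] --> (0 : V) -> n @ \oo --> \oo ->
  (forall j, (n j <= m j <= n j + s)%N) ->
  x (m j) - x (n j) @[j --> \oo] --> (0 : V).
Proof.
move=> x_step n_oo nm.
have shift t : x (t + k)%N - x k @[k --> \oo] --> (0 : V).
  elim: t => [|t IHt].
    by under eq_fun do rewrite add0n subrr; exact: cvg_cst.
  have -> : (fun k => x (t.+1 + k)%N - x k) =
      (fun k => (x (t + k).+1 - x (t + k)%N) + (x (t + k)%N - x k)).
    by apply/funext => k; rewrite addSn addrA subrK.
  rewrite -[0]addr0; apply: cvgD IHt.
  exact: (cvg_comp _ _ (@cvg_addnl t) x_step).
apply/cvgr0Pnorm_le => e e0.
have near_k :
    \forall k \near \oo, forall t : 'I_s.+1, `|x (t + k)%N - x k| <= e.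
  by apply: filter_forall => t; exact: cvgr0_norm_le (shift t) _ e0.
have near_nk : \forall j \near \oo,
    forall t : 'I_s.+1, `|x (t + n j)%N - x (n j)| <= e := n_oo _ near_k.
apply: filterS near_nk => j xj.
have /andP[nmj mnj] := nm j.
have ts : (m j - n j < s.+1)%N by rewrite ltnS leq_subLR.
by have := xj (Ordinal ts); rewrite /= subnK.
Qed.

End SmallSteps.

Theorem theorem2p1 (R : realType) (p : nat)
  (H : hilbertType R) (Hi : 'I_p -> hilbertType R)
  (C : 'I_p -> set H) (Q : forall i : 'I_p, set (Hi i))
  (A : forall i : 'I_p, {linear H -> Hi i})
  (C_nonempty : forall i, C i !=set0)
  (C_closed : forall i, closed (C i))
  (C_convex : forall i, convex_set (C i))
  (Q_nonempty : forall i, Q i !=set0)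
  (Q_closed : forall i, closed (Q i))
  (Q_convex : forall i, convex_set (Q i))
  (A_bounded : forall i, bounded_near (A i) (nbhs (0 : H)))
  (A_nonzero : forall i, exists x : H, A i x != 0)
  (Omega_nonempty : \bigcap_(i : 'I_p) (C i `&` A i @^-1` Q i) !=set0)
  (S : forall i : 'I_p, Hi i -> Hi i) (U : 'I_p -> H -> H)
  (S_weakly_regular : forall i, weakly_regular (S i))
  (S_cutter : forall i, cutter (S i))
  (U_weakly_regular : forall i, weakly_regular (U i))
  (U_cutter : forall i, cutter (U i))
  (FixS : forall i, Fix (S i) = Q i)
  (FixU : forall i, Fix (U i) = C i)
  (eps : R) (eps_gt0 : 0 < eps) (eps_lt1 : eps < 1)
  (lambda mu : nat -> R)
  (lambda_bounds : forall k, eps <= lambda k <= 2 - eps)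
  (mu_bounds : forall k, eps <= mu k <= 2 - eps)
  (ctrl : nat -> 'I_p) (ctrl_almost_cyclic : almost_cyclic ctrl)
  (x0 : H) (x : nat -> H) (x_0 : x 0%N = x0)
  (x_S : forall k : nat, let i := ctrl k in
     x k.+1 = relaxation (mu k) (U i)
       (x k + (lambda k / opnorm (A i) ^+ 2)
                *: adjoint (A i) (S i (A i (x k)) - A i (x k)))) :
  exists xstar : H,
    (\bigcap_(i : 'I_p) (C i `&` A i @^-1` Q i)) xstar /\ weak_cvg x xstar.
Proof.
(* The index is a variable [i] equal to [ctrl k], so that residuals taken at
   different times lie in one space [Hi i]. *)
have step z k i : (\bigcap_i (C i `&` A i @^-1` Q i)) z -> ctrl k = i ->
    let r := S i (A i (x k)) - A i (x k) in
    let y := x k + (lambda k / opnorm (A i) ^+ 2) *: adjoint (A i) r in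
    let delta := Num.sqrt (`|x k - z| ^+ 2 - `|x k.+1 - z| ^+ 2) / eps in
    [/\ `|x k.+1 - z| <= `|x k - z|, `|r| <= delta * opnorm (A i),
     `|U i y - y| <= delta * 1, `|y - x k| <= delta * 2
     & `|x k.+1 - x k| <= delta * 4].
  move=> Omz <- r y delta; have [Cz Qz] := Omz (ctrl k) I.
  rewrite -FixU in Cz; rewrite /= -FixS in Qz.
  by rewrite /delta x_S; exact: split_step.
apply: fejer_weak_cvg => // [z k Omz|n l n_oo xl i _].
  by have [] := step z k _ Omz erefl.
have [z Omz] := Omega_nonempty.
pose delta k := Num.sqrt (`|x k - z| ^+ 2 - `|x k.+1 - z| ^+ 2) / eps.
have delta0 : delta @ \oo --> 0.
  have /cvg_ex[c Vc] : cvg (`|x k - z| ^+ 2 @[k --> \oo]).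
    apply: nonincreasing_bounded_cvg => k; first exact: sqr_ge0.
    by rewrite ler_sqr ?nnegrE//; have [] := step z k _ Omz erefl.
  rewrite -(mul0r eps^-1); apply: cvgM (cvg_cst _).
  rewrite -(@sqrtr0 R) -(subrr c).
  apply: continuous_cvg; first exact: sqrt_continuous.
  apply: cvgB => //.
  by rewrite (cvg_shiftS (fun k => `|x k - z| ^+ 2)).
have cvg0 (W : hilbertType R) (v : nat -> W) m a : m @ \oo --> \oo ->
    (forall j, `|v j| <= delta (m j) * a) -> v @ \oo --> 0.
  move=> m_oo vP; apply: (@cvg_dist_le _ _ _ _ _ _ _ (delta \o m) a).
    exact: cvg_comp delta0.
  by move=> j; rewrite subr0.
(* [m j] is a time within [s] steps after [n j] at which [i] is active. *)
have [s _ ctrlP] := ctrl_almost_cyclic.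
have ex_m j : exists m, (n j <= m <= n j + s)%N /\ ctrl m = i.
  have [m /= /andP[nm mn] mi] := ctrlP (n j) i I.
  by exists m; rewrite mn (leq_trans (leq_addr _ _) nm).
have [m mP] := choice ex_m.
have m_oo : m @ \oo --> \oo.
  apply/cvgnyPge => N; move/cvgnyPge/(_ N): n_oo; apply: filterS => j Nj.
  by have /andP[nm _] := (mP j).1; exact: leq_trans nm.
have stepm j := step z (m j) i Omz (mP j).2.
have x_step : x k.+1 - x k @[k --> \oo] --> (0 : H).
  apply: (cvg0 _ _ id 4 cvg_id) => k.
  by have [] := step z k _ Omz erefl.
have xml : weak_cvg (x \o m) l.
  apply: (weak_cvg_sub0 xl).
  by apply: small_steps x_step n_oo _ => j; exact: (mP j).1.
split.
  rewrite -FixU.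
  pose y j := x (m j) + (lambda (m j) / opnorm (A i) ^+ 2)
    *: adjoint (A i) (S i (A i (x (m j))) - A i (x (m j))).
  apply: (U_weakly_regular i y).
    apply: (weak_cvg_sub0 xml); apply: (cvg0 _ _ m 2 m_oo) => j.
    by have [] := stepm j.
  apply: (cvg0 _ _ m 1 m_oo) => j.
  by rewrite distrC; have [] := stepm j.
rewrite /= -FixS.
apply: (S_weakly_regular i (A i \o (x \o m))); first exact: weak_cvg_linear.
apply: (cvg0 _ _ m (opnorm (A i)) m_oo) => j.
by rewrite distrC; have [] := stepm j.
Qed.
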